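(* Let $L$ be a finite-dimensional non-solvable Lie algebra over a field $F$. Then every $3$-maximal subalgebra of $L$ is an ideal of $L$ if and only if one of the following holds: (i) $L$ is simple, all $2$-maximal subalgebras of $L$ are at most one-dimensional and at least one of them has dimension one; (ii) $L/Z(L)$ is a simple algebra, all of whose maximal subalgebras are one-dimensional, $Z(L)=\phi(L)$ and $\dim Z(L)=0$ or $1$; (iii) $L=S\dot{+}Fx$ for some $x \in L$, where $S$ is a simple ideal of $L$ and all maximal subalgebras of $S$ are one-dimensional.
   Context: For a positive integer $n$, an $n$-maximal subalgebra of $L$ is a subalgebra $S_0$ for which there is a chain $S_0<S_1<\cdots<S_n=L$ of subalgebras with each $S_i$ a maximal subalgebra of $S_{i+1}$. $\phi(L)$ is the Frattini ideal of $L$: the largest ideal of $L$ contained in the intersection of all maximal subalgebras of $L$. $Z(L)$ is the centre of $L$. $\dot{+}$ denotes a direct sum of vector spaces. *)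

(* Defs.v *)
From HB Require Import structures.
From mathcomp Require Import all_boot all_order all_algebra.
From mathcomp Require Import generic_quotient ring_quotient.
From mathcomp Require Import boolp.

Set Implicit Arguments.
Unset Strict Implicit.
Unset Printing Implicit Defensive.

Import GRing.Theory VectorInternalTheory.
Local Open Scope ring_scope.
Local Open Scope quotient_scope.

HB.mixin Record Vector_isLieAlgebra (F : fieldType) L of Vector F L := {
  lie : L -> L -> L;
  liePl : forall (a : F) (x y z : L), lie (a *: x + y) z = a *: lie x z + lie y z;
  liePr : forall (a : F) (x y z : L), lie z (a *: x + y) = a *: lie z x + lie z y;
  liexx : forall x : L, lie x x = 0;
  lie_jacobi : forall x y z : L,
    lie x (lie y z) + lie y (lie z x) + lie z (lie x y) = 0
}.

(* Finite dimension comes from the vectType structure; the bracket is alternating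
   (not just antisymmetric), so characteristic 2 is covered. *)
#[short(type="lieAlgType")]
HB.structure Definition LieAlgebra (F : fieldType) :=
  {L of Vector_isLieAlgebra F L & Vector F L}.

Section LieTheory.
Variables (F : fieldType) (L : lieAlgType F).
Implicit Types (x y z : L) (U V W S M I : {vspace L}).

Definition lier y x := lie x y.

Fact lie_is_linear x : linear (lie x : L -> L).
Proof. by move=> a y z; rewrite liePr. Qed.
HB.instance Definition _ x :=
  GRing.isSemilinear.Build F L L *:%R (lie x)
    (GRing.semilinear_linear (lie_is_linear x)).

Fact lier_is_linear y : linear (lier y).
Proof. by move=> a x z; rewrite /lier liePl. Qed.
HB.instance Definition _ y :=
  GRing.isSemilinear.Build F L L *:%R (lier y)
    (GRing.semilinear_linear (lier_is_linear y)).

Lemma lie0l y : lie 0 y = 0 :> L. Proof. exact: (linear0 (lier y)). Qed.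
Lemma lie0r y : lie y 0 = 0 :> L. Proof. exact: linear0. Qed.
Lemma lieDl x y z : lie (x + y) z = lie x z + lie y z.
Proof. exact: (linearD (lier z)). Qed.
Lemma lieDr x y z : lie z (x + y) = lie z x + lie z y.
Proof. exact: linearD. Qed.
Lemma lieBl x y z : lie (x - y) z = lie x z - lie y z.
Proof. exact: (linearB (lier z)). Qed.
Lemma lieBr x y z : lie z (x - y) = lie z x - lie z y.
Proof. exact: linearB. Qed.
Lemma lieZl a x z : lie (a *: x) z = a *: lie x z.
Proof. by rewrite -[lie _ z]/(lier z _) linearZ. Qed.
Lemma lieZr a x z : lie z (a *: x) = a *: lie z x.
Proof. by rewrite linearZ. Qed.

Lemma lieC x y : lie x y = - lie y x.
Proof.
apply/eqP; rewrite -addr_eq0; apply/eqP; have := liexx (x + y).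
by rewrite lieDl !lieDr !liexx add0r addr0.
Qed.

(* [U, V], the span of all brackets [u, v] with u in U and v in V. *)
Definition lie_prod U V : {vspace L} :=
  <<[seq lie x y | x <- vbasis U, y <- vbasis V]>>%VS.

Lemma memv_lie U V x y : x \in U -> y \in V -> lie x y \in lie_prod U V.
Proof.
move=> Ux Vy; rewrite (coord_vbasis Ux) -/(lier y _) linear_sum /=.
apply: rpred_sum => i _; rewrite linearZ /=; apply: rpredZ.
rewrite /lier (coord_vbasis Vy) linear_sum /=.
apply: rpred_sum => j _; rewrite linearZ /=; apply: rpredZ.
by apply/memv_span/allpairs_f; rewrite mem_nth ?size_tuple.
Qed.

Lemma lie_prodP U V W :
  reflect (forall x y, x \in U -> y \in V -> lie x y \in W)
          (lie_prod U V <= W)%VS.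
Proof.
apply: (iffP idP) => [/subvP sW x y Ux Vy | UVW].
  exact/sW/memv_lie.
apply/span_subvP => _ /allpairsP[[x y] [/= Ux Vy ->]].
by apply: UVW; apply: vbasis_mem.
Qed.

Definition subalgebra U : bool := (lie_prod U U <= U)%VS.

Definition is_lie_ideal I : bool := (lie_prod fullv I <= I)%VS.

Lemma subalgebraP U :
  reflect (forall x y, x \in U -> y \in U -> lie x y \in U) (subalgebra U).
Proof. exact: lie_prodP. Qed.

Lemma is_lie_idealP I :
  reflect (forall x y, y \in I -> lie x y \in I) (is_lie_ideal I).
Proof.
apply: (iffP (lie_prodP _ _ _)) => h x y; last by move=> _; apply: h.
by apply: h; rewrite memvf.
Qed.

Definition maximal_subalgebra M U : Prop :=
  [/\ subalgebra M, (M <= U)%VS, M <> U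
    & forall K, subalgebra K -> (M <= K)%VS -> (K <= U)%VS -> K = M \/ K = U].

(* Meaningful for n > 0: there is a chain M = C 0 < C 1 < ... < C n = L. *)
Definition n_maximal_subalgebra (n : nat) M : Prop :=
  exists C : nat -> {vspace L},
    [/\ C 0%N = M, C n = fullv
      & forall i, (i < n)%N -> maximal_subalgebra (C i) (C i.+1)].

(* S, viewed as a Lie algebra in its own right, is simple: it is non-abelian
   and its only ideals are 0 and S. *)
Definition lie_simple S : Prop :=
  [/\ subalgebra S, lie_prod S S <> 0%VS
    & forall I, (I <= S)%VS -> (lie_prod S I <= I)%VS -> I = 0%VS \/ I = S].

Definition derived_series (n : nat) : {vspace L} :=
  iter n (fun U => lie_prod U U) fullv.

Definition lie_center : {vspace L} :=
  (\bigcap_(y <- vbasis (fullv : {vspace L})) lker (linfun (lier y)))%VS.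

Lemma lie_centerP x : reflect (forall y, lie x y = 0) (x \in lie_center).
Proof.
rewrite memvE.
apply: (iffP idP) => [xZ y | xZ].
  rewrite (coord_vbasis (memvf y)) linear_sum big1 // => i _.
  rewrite linearZ /=; set z := _`_i.
  have zB : z \in vbasis (fullv : {vspace L}) by rewrite mem_nth ?size_tuple.
  move: xZ; rewrite /lie_center (big_rem z zB) /= subv_cap => /andP[xz _].
  by move: xz; rewrite -memvE memv_ker lfunE /= /lier => /eqP->; rewrite scaler0.
rewrite /lie_center; elim/big_ind: _ => [|U V hU hV|y _]; first exact: subvf.
  by rewrite subv_cap hU.
by rewrite -memvE memv_ker lfunE /= /lier xZ.
Qed.

Definition frattini_below J : Prop :=
  is_lie_ideal J /\ forall M, maximal_subalgebra M fullv -> (J <= M)%VS.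

Lemma frattini_ex :
  exists P, frattini_below P /\ forall J, frattini_below J -> (J <= P)%VS.
Proof.
have ex0 : exists n, `[< exists J, frattini_below J /\ \dim J = n >].
  exists 0%N; apply/asboolP; exists 0%VS; split; last exact: dimv0.
  split=> [|M _]; last exact: sub0v.
  by apply/is_lie_idealP => x y; rewrite memv0 => /eqP->; rewrite lie0r mem0v.
have bd n : `[< exists J, frattini_below J /\ \dim J = n >] -> (n <= \dim {:L})%N.
  by move=> /asboolP[J [_ <-]]; apply/dimvS/subvf.
case: (ex_maxnP ex0 bd) => n /asboolP[P [[Pid PM] dP]] nmax.
exists P; split=> // J [Jid JM].
have /nmax : `[< exists K, frattini_below K /\ \dim K = \dim (P + J) >].
  apply/asboolP; exists (P + J)%VS; split=> //; split; last first.
    by move=> M Mmax; rewrite subv_add PM // JM.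
  apply/is_lie_idealP => x _ /memv_addP[u uP [v vJ ->]]; rewrite lieDr.
  by apply: memv_add; [apply: (is_lie_idealP _ Pid) | apply: (is_lie_idealP _ Jid)].
rewrite -dP => le_dim.
have /eqP -> : P == (P + J)%VS by rewrite eqEdim addvSl le_dim.
exact: addvSr.
Qed.

(* The largest ideal contained in the intersection of all maximal subalgebras;
   see frattiniP. *)
Definition frattini : {vspace L} := projT1 (cid frattini_ex).

Lemma frattiniP :
  frattini_below frattini /\ forall J, frattini_below J -> (J <= frattini)%VS.
Proof. by rewrite /frattini; case: cid. Qed.

Record lie_ideal := LieIdeal {
  lie_ideal_val :> {vspace L};
  lie_idealP : is_lie_ideal lie_ideal_val
}.

Fact center_ideal : is_lie_ideal lie_center.
Proof.
by apply/is_lie_idealP => x y /lie_centerP yZ; rewrite lieC yZ oppr0 mem0v.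
Qed.

Definition center_lie_ideal : lie_ideal := LieIdeal center_ideal.

End LieTheory.

Arguments lie_center {F} L.
Arguments frattini {F} L.
Arguments center_lie_ideal {F} L.

Definition lie_solvable (F : fieldType) (L : lieAlgType F) : Prop :=
  exists n, derived_series L n = 0%VS.

(* The quotient Lie algebra L / I on the type of classes modulo I;
   \pi is the canonical projection L -> L / I. *)
Section LieQuotient.
Variables (F : fieldType) (L : lieAlgType F) (I : lie_ideal L).

Definition lie_quot : Type := Quotient.quot (pred_of_vspace (lie_ideal_val I)).

HB.instance Definition _ := GRing.Zmodule.on lie_quot.
HB.instance Definition _ := ZmodQuotient.on lie_quot.

Implicit Types (x y z : L) (p q r : lie_quot).
Local Notation cls x := (\pi_lie_quot x).

Lemma lie_quot_eq x y : (cls x == cls y) = (x - y \in lie_ideal_val I).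
Proof. exact/esym/Quotient.idealrBE. Qed.

Lemma lie_quot_eq0 x : (cls x == 0) = (x \in lie_ideal_val I).
Proof. by rewrite -(@pi_zeror _ _ _ _ _ lie_quot) lie_quot_eq subr0. Qed.

Definition quot_scale (a : F) q : lie_quot := cls (a *: repr q).
Definition quot_lie q r : lie_quot := cls (lie (repr q) (repr r)).

Lemma quot_piD x y : cls (x + y) = cls x + cls y.
Proof. exact: (@pi_addr _ _ _ _ _ lie_quot). Qed.

Lemma quot_piZ a x : cls (a *: x) = quot_scale a (cls x).
Proof.
apply/eqP; rewrite lie_quot_eq -scalerBr rpredZ //.
by rewrite -lie_quot_eq reprK.
Qed.

Lemma quot_pi_lie x y : cls (lie x y) = quot_lie (cls x) (cls y).
Proof.
apply/eqP; rewrite lie_quot_eq.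
have hI z : z - repr (cls z) \in lie_ideal_val I by rewrite -lie_quot_eq reprK.
set x' := repr (cls x); set y' := repr (cls y).
have -> : lie x y - lie x' y' = lie x (y - y') - lie y' (x - x').
  rewrite !lieBr (lieC y' x) (lieC y' x') opprB opprK [- _ + _]addrC.
  by rewrite addrA subrK.
by rewrite rpredB //; apply: (is_lie_idealP _ (lie_idealP I)); apply: hI.
Qed.

Fact quot_scaleA a b q : quot_scale a (quot_scale b q) = quot_scale (a * b) q.
Proof.
elim/quotW: q => x.
by rewrite -(quot_piZ b) -(quot_piZ a) -(quot_piZ (a * b)) scalerA.
Qed.
Fact quot_scale1 : left_id 1 quot_scale.
Proof. by elim/quotW => x; rewrite -(quot_piZ 1 x) scale1r. Qed.
Fact quot_scaleDr : right_distributive quot_scale +%R.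
Proof.
move=> a; elim/quotW => x; elim/quotW => y.
by rewrite -quot_piD -(quot_piZ a x) -(quot_piZ a y) -quot_piZ -quot_piD scalerDr.
Qed.
Fact quot_scaleDl q : {morph quot_scale^~ q : a b / a + b}.
Proof.
elim/quotW: q => x a b.
by rewrite -(quot_piZ a x) -(quot_piZ b x) -quot_piZ -quot_piD scalerDl.
Qed.

HB.instance Definition _ := GRing.Zmodule_isLmodule.Build F lie_quot
  quot_scaleA quot_scale1 quot_scaleDr quot_scaleDl.

Fact quot_pi_is_linear : linear (\pi_lie_quot : L -> lie_quot).
Proof. by move=> a x y; rewrite quot_piD quot_piZ. Qed.

(* L / I is linearly isomorphic to any complement of I in L. *)
Fact lie_quot_vect_iso : Vector.axiom (\dim (lie_ideal_val I)^C) lie_quot.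
Proof.
pose C := ((lie_ideal_val I)^C)%VS.
pose f (u : subvs_of C) : lie_quot := cls (vsval u).
have f_lin : linear f by move=> a u v; rewrite /f /= quot_pi_is_linear.
have f_inj : injective f.
  move=> u v /eqP; rewrite lie_quot_eq => uvI; apply: val_inj; apply/eqP.
  rewrite -subr_eq0 -memv0 -(capv_compl (lie_ideal_val I)) memv_cap uvI.
  by rewrite rpredB ?subvsP.
have f_surj q : exists u, f u == q.
  have := memvf (repr q); rewrite -(addv_complf (lie_ideal_val I)).
  case/memv_addP => i iI [c cC def_q]; exists (Subvs cC).
  rewrite -[q in _ == q]reprK eq_sym lie_quot_eq def_q /=.
  by rewrite addrK.
pose g q : subvs_of C := xchoose (f_surj q).
have gK : cancel g f by move=> q; apply/eqP/(xchooseP (f_surj q)).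
have fK : cancel f g by move=> u; apply: f_inj; rewrite gK.
have g_lin : linear g by move=> a q r; apply: f_inj; rewrite f_lin !gK.
exists (fun q => v2r (g q)); first by move=> a q r; rewrite g_lin linearP.
exists (fun w => f (r2v w)) => [q | w]; first by rewrite v2rK gK.
by rewrite fK r2vK.
Qed.

HB.instance Definition _ := Lmodule_hasFinDim.Build F lie_quot lie_quot_vect_iso.

Fact quot_liePl a p q r :
  quot_lie (a *: p + q) r = a *: quot_lie p r + quot_lie q r.
Proof.
elim/quotW: p => x; elim/quotW: q => y; elim/quotW: r => z.
rewrite -quot_pi_is_linear -(quot_pi_lie x z) -(quot_pi_lie y z) -quot_pi_lie.
by rewrite liePl quot_pi_is_linear.
Qed.
Fact quot_liePr a p q r :
  quot_lie r (a *: p + q) = a *: quot_lie r p + quot_lie r q.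
Proof.
elim/quotW: p => x; elim/quotW: q => y; elim/quotW: r => z.
rewrite -quot_pi_is_linear -(quot_pi_lie z x) -(quot_pi_lie z y) -quot_pi_lie.
by rewrite liePr quot_pi_is_linear.
Qed.
Fact quot_liexx q : quot_lie q q = 0.
Proof.
elim/quotW: q => x; rewrite -(quot_pi_lie x x) liexx; apply/eqP.
by rewrite lie_quot_eq0 mem0v.
Qed.
Fact quot_lie_jacobi p q r :
  quot_lie p (quot_lie q r) + quot_lie q (quot_lie r p)
    + quot_lie r (quot_lie p q) = 0.
Proof.
elim/quotW: p => x; elim/quotW: q => y; elim/quotW: r => z.
rewrite -(quot_pi_lie y z) -(quot_pi_lie z x) -(quot_pi_lie x y).
rewrite -(quot_pi_lie x) -(quot_pi_lie y) -(quot_pi_lie z) -!quot_piD.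
by rewrite lie_jacobi; apply/eqP; rewrite lie_quot_eq0 mem0v.
Qed.

HB.instance Definition _ := Vector_isLieAlgebra.Build F lie_quot
  quot_liePl quot_liePr quot_liexx quot_lie_jacobi.

Lemma lie_quot_pi x y : cls (lie x y) = lie (cls x) (cls y).
Proof. exact: quot_pi_lie. Qed.

End LieQuotient.

(* Main.v *)
(* A 2-maximal subalgebra K of dimension at least 2 has two distinct maximal
   subalgebras; these are ideals of L, so K is their sum, an ideal of L.  Such a
   K cannot exist when L is not solvable: for K < M < L and A maximal in K, a
   second 2-maximal subalgebra between A and M shows that M is an ideal, so L / K
   is solvable and K contains a nonzero perfect P; but K is nilpotent, since all
   its maximal subalgebras are ideals (Barnes).  Hence every 2-maximal subalgebra
   has dimension at most 1, and a maximal subalgebra is either simple with all its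
   maximal subalgebras of dimension 1, or has dimension at most 2.  Applying this
   to a maximal subalgebra above a proper nonzero ideal I of a non-simple L gives
   (iii) in the first case; in the second case I is a line, L is perfect, so I is
   central and equal to Z(L), which lies in every maximal subalgebra: this is (ii). *)
Require Import Defs.
From HB Require Import structures.
From mathcomp Require Import all_boot all_order all_algebra.
From mathcomp Require Import generic_quotient boolp.

Set Implicit Arguments.
Unset Strict Implicit.
Unset Printing Implicit Defensive.

Import GRing.Theory.

(** A subspace of largest dimension among those inside [p] absorbs every vector that satisfies [p].
    This turns the Fitting null component of [lie x] and the centralizer of a vector into
    subspaces. *)
Lemma vspace_of_pred (F : fieldType) (E : vectType F) (p : E -> Prop) :
    p 0%R -> (forall a x y, p x -> p y -> p (a *: x + y)%R) ->
  exists U : {vspace E}, forall x, x \in U <-> p x.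
Proof.
move=> p0 pD.
have pDl x y : p x -> p y -> p (x + y)%R by move=> px py; rewrite -[x]scale1r; exact: pD.
have pZ a x : p x -> p (a *: x)%R by move=> px; rewrite -[(a *: x)%R]addr0; exact: pD.
pose q n := `[< exists U : {vspace E}, (forall x, x \in U -> p x) /\ \dim U = n >].
have ex0 : exists n, q n.
  exists 0; apply/asboolP; exists 0%VS; split; last exact: dimv0.
  by move=> x; rewrite memv0 => /eqP->.
have bd n : q n -> n <= \dim {:E} by move=> /asboolP[U [_ <-]]; apply/dimvS/subvf.
case: (ex_maxnP ex0 bd) => n /asboolP[U [Up dU]] nmax; exists U => x.
split=> [|px]; first exact: Up.
have /nmax : q (\dim (U + <[x]>)).
  apply/asboolP; exists (U + <[x]>)%VS; split=> // _ /memv_addP[u uU [_ /vlineP[a ->] ->]].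
  by apply: pDl; [apply: Up | apply: pZ].
rewrite -dU => le_dim.
have /eqP -> : U == (U + <[x]>)%VS by rewrite eqEdim addvSl le_dim.
by apply: (subvP (addvSr _ _)); apply: memv_line.
Qed.

(** * Subalgebras, maximal ideals and perfect subalgebras *)

Section LieLemmas.
Variables (F : fieldType) (L : lieAlgType F).
Implicit Types (x y z : L) (A B K M P U V W : {vspace L}).

Lemma dimv_ltn U V : (U <= V)%VS -> U <> V -> \dim U < \dim V.
Proof.
move=> sUV neq; rewrite ltnNge; apply/negP => le_dim; apply: neq.
by apply/eqP; rewrite eqEdim sUV.
Qed.

Lemma memv_neq U V : (U <= V)%VS -> U <> V -> exists2 x, x \in V & x \notin U.
Proof.
move=> sUV neq; apply/subvPn/negP => sVU; apply: neq.
by apply/eqP; rewrite eqEsubv sUV.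
Qed.

Lemma dimv_add_line U x : \dim (U + <[x]>) <= (\dim U).+1.
Proof.
apply: leq_trans (dimv_add_leqif _ _) _.
by rewrite dim_vline -addn1 leq_add2l leq_b1.
Qed.

Lemma add_line_neq U x : x \notin U -> U <> (U + <[x]>)%VS.
Proof.
by move=> xU e; move: xU; rewrite e (subvP (addvSr _ _)) // memv_line.
Qed.

Lemma lie_leibniz x y z : lie x (lie y z) = (lie (lie x y) z + lie y (lie x z))%R.
Proof.
apply/eqP; rewrite -subr_eq0 opprD addrA -(lie_jacobi x y z); apply/eqP.
by rewrite (lieC z (lie x y)) (lieC z x) linearN addrAC.
Qed.

Lemma lie_prodS U U' V V' :
  (U <= U')%VS -> (V <= V')%VS -> (lie_prod U V <= lie_prod U' V')%VS.
Proof.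
move=> sU sV; apply/lie_prodP => x y xU yV.
by apply: memv_lie; [apply: (subvP sU) | apply: (subvP sV)].
Qed.

Lemma subalgebra0 : subalgebra (0%VS : {vspace L}).
Proof. by apply/subalgebraP => x y; rewrite memv0 => /eqP-> _; rewrite lie0l mem0v. Qed.

Lemma subalgebra_line x : subalgebra <[x]>.
Proof.
apply/subalgebraP => _ _ /vlineP[a ->] /vlineP[b ->].
by rewrite lieZl lieZr liexx !scaler0 mem0v.
Qed.

Lemma subalgebra_add_line U x :
  subalgebra U -> (forall u, u \in U -> lie u x \in U) -> subalgebra (U + <[x]>).
Proof.
move=> /subalgebraP sU Ux; apply/subalgebraP => y z.
move=> /memv_addP[u uU [_ /vlineP[a ->] ->]] /memv_addP[v vU [_ /vlineP[b ->] ->]].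
apply: (subvP (addvSl U <[x]>)).
rewrite !lieDl !lieDr !lieZl !lieZr liexx !scaler0 addr0 (lieC x v).
by rewrite !rpredD ?rpredZ ?rpredN ?Ux ?sU.
Qed.

Lemma ideal_subalgebra U V : (U <= V)%VS -> (lie_prod V U <= U)%VS -> subalgebra U.
Proof. by move=> sUV; apply: subv_trans; apply: lie_prodS. Qed.

Lemma lie_ideal_in U V : is_lie_ideal U -> (lie_prod V U <= U)%VS.
Proof. by apply: subv_trans; apply: lie_prodS; rewrite ?subvf. Qed.

Lemma lie_ideal_add U V : is_lie_ideal U -> is_lie_ideal V -> is_lie_ideal (U + V).
Proof.
move=> /is_lie_idealP iU /is_lie_idealP iV; apply/is_lie_idealP => x y.
by move=> /memv_addP[u uP [v vJ ->]]; rewrite lieDr memv_add ?iU ?iV.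
Qed.

Lemma max_subalgebra_ex U V : subalgebra U -> (U <= V)%VS -> U <> V ->
  exists2 M, maximal_subalgebra M V & (U <= M)%VS.
Proof.
move=> sU sUV neq.
pose q n := `[< exists W, [/\ subalgebra W, (U <= W)%VS, (W <= V)%VS, W <> V & \dim W = n] >].
have ex0 : exists n, q n by exists (\dim U); apply/asboolP; exists U.
have bd n : q n -> n <= \dim V by move=> /asboolP[W [_ _ sW _ <-]]; apply: dimvS.
case: (ex_maxnP ex0 bd) => n /asboolP[W [sW sUW sWV nW dW]] nmax.
exists W => //; split=> // K sK sWK sKV.
case: (pselect (K = V)) => [->|nK]; [by right | left].
have /nmax : q (\dim K) by apply/asboolP; exists K; split=> //; apply: subv_trans sWK.
by rewrite -dW => le_dim; apply/esym/eqP; rewrite eqEdim sWK.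
Qed.

(** Any vector normalizes the ideal [M], so adjoining one already gives a subalgebra, and maximality
    leaves only [V]. *)
Lemma max_ideal_add_line M V x : maximal_subalgebra M V ->
  (lie_prod V M <= M)%VS -> x \in V -> x \notin M -> V = (M + <[x]>)%VS.
Proof.
move=> [sM sMV _ hmax] /lie_prodP iM xV xM.
have sK : subalgebra (M + <[x]>).
  by apply: subalgebra_add_line => // u uM; rewrite lieC memvN iM.
case: (hmax _ sK (addvSl _ _)) => [|/esym e|-> //].
  by rewrite subv_add sMV.
by case: (add_line_neq xM).
Qed.

(** Since [lie x x] vanishes, every bracket in the extension reduces to brackets with a factor in
    [M]. *)
Lemma lie_prod_add_line M x : subalgebra M -> (forall u, u \in M -> lie u x \in M) ->
  (lie_prod (M + <[x]>) (M + <[x]>) <= M)%VS.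
Proof.
move=> /subalgebraP sM Mx; apply/lie_prodP => y z.
move=> /memv_addP[u uU [_ /vlineP[a ->] ->]] /memv_addP[v vU [_ /vlineP[b ->] ->]].
rewrite !lieDl !lieDr !lieZl !lieZr liexx !scaler0 addr0 (lieC x v).
by rewrite !rpredD ?rpredZ ?rpredN ?Mx ?sM.
Qed.

Lemma max_ideal_codim1 M V : maximal_subalgebra M V -> (lie_prod V M <= M)%VS ->
  (lie_prod V V <= M)%VS /\ \dim V = (\dim M).+1.
Proof.
move=> mM iM; have [sM sMV neq _] := mM.
have [x xV xM] := memv_neq sMV neq.
have eV := max_ideal_add_line mM iM xV xM.
split.
  rewrite eV; apply: lie_prod_add_line => // u uM.
  by rewrite lieC memvN; apply: (lie_prodP _ _ _ iM).
by apply/eqP; rewrite eqn_leq dimv_ltn // andbT {1}eV dimv_add_line.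
Qed.

Lemma codim1_maximal M V : subalgebra M -> (M <= V)%VS -> \dim V = (\dim M).+1 ->
  maximal_subalgebra M V.
Proof.
move=> sM sMV dV; split=> // [e|K sK sMK sKV]; first by move: dV; rewrite e => /n_Sn.
case: (pselect (K = M)) => [|nK]; [by left | right].
apply/eqP; rewrite eqEdim sKV dV dimv_ltn // => e; exact: nK.
Qed.

(** If [x] and [y] span [P], all brackets lie on the line of [lie x y]; so a perfect algebra of
    dimension at most two would be at most a line, which is abelian. *)
Lemma dim_perfect P : lie_prod P P = P -> P <> 0%VS -> 2 < \dim P.
Proof.
move=> pP nP; rewrite ltnNge; apply/negP => dP.
have [x xP] := memv_neq (sub0v P) (not_eq_sym nP).
rewrite memv0 => nx.
have sx : (<[x]> <= P)%VS by rewrite -memvE.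
case: (pselect (<[x]>%VS = P)) => [e | nxP].
  apply: nP; rewrite -pP; apply/eqP; rewrite -subv0; apply/lie_prodP.
  by rewrite -e => _ _ /vlineP[a ->] /vlineP[b ->]; rewrite lieZl lieZr liexx !scaler0 mem0v.
have [y yP yx] := memv_neq sx nxP.
have eP : (<[x]> + <[y]>)%VS = P.
  apply/eqP; rewrite eqEdim subv_add sx -memvE yP /= (leq_trans dP) //.
  by have := dimv_ltn (addvSl _ _) (add_line_neq yx); rewrite dim_vline nx.
have : (lie_prod P P <= <[lie x y]>)%VS.
  apply/lie_prodP; rewrite -eP => u v.
  move=> /memv_addP[_ /vlineP[a ->] [_ /vlineP[b ->] ->]].
  move=> /memv_addP[_ /vlineP[c ->] [_ /vlineP[d ->] ->]].
  rewrite !lieDl !lieDr !lieZl !lieZr !liexx !scaler0 addr0 add0r (lieC y x).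
  by rewrite !rpredD ?rpredZ ?rpredN ?memv_line.
rewrite pP => /dimvS; rewrite dim_vline => d1.
have : \dim <[x]> < \dim P by apply: dimv_ltn.
by rewrite dim_vline nx ltnNge (leq_trans d1) ?leq_b1.
Qed.

(** The derived series decreases, so a term of least dimension equals its own derived algebra;
    non-solvability keeps it nonzero. *)
Lemma nonsolvable_perfect :
  ~ lie_solvable L -> exists2 P : {vspace L}, lie_prod P P = P & P <> 0%VS.
Proof.
move=> nsol.
have dec n : (derived_series L n.+1 <= derived_series L n)%VS.
  by elim: n => [|n IH]; [exact: subvf | apply: lie_prodS; exact: IH].
pose q n := `[< exists k, \dim (derived_series L k) = n >].
have ex0 : exists n, q n by eexists; apply/asboolP; exists 0.
case: (ex_minnP ex0) => n /asboolP[k <-] nmin.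
exists (derived_series L k); last by move=> e; apply: nsol; exists k.
apply/eqP; rewrite eqEdim dec; apply: nmin; apply/asboolP.
by exists k.+1.
Qed.

Lemma perfect_sub P V : lie_prod P P = P -> (P <= V)%VS -> (P <= lie_prod V V)%VS.
Proof. by move=> pP sPV; rewrite -pP; apply: lie_prodS. Qed.

(** * Nilpotency of adjoint maps and Engel's theorem *)

Lemma iter_lieP n x a u v :
  iter n (lie x) (a *: u + v)%R = (a *: iter n (lie x) u + iter n (lie x) v)%R.
Proof. by elim: n => //= n ->; rewrite liePr. Qed.

Lemma iter_lie0 n x : iter n (lie x) 0%R = 0%R.
Proof. by elim: n => //= n ->; rewrite lie0r. Qed.

Lemma iter_lie_eq0 m n x y :
  m <= n -> iter m (lie x) y = 0%R -> iter n (lie x) y = 0%R.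
Proof. by move=> /subnK <- e; rewrite iterD e iter_lie0. Qed.

(** [lie x] is a derivation: the Leibniz rule spends one application on either factor, whence the
    induction on the sum [m + n]. It makes the Fitting null component a subalgebra. *)
Lemma iter_lie_lie m n x y z :
    iter m (lie x) y = 0%R -> iter n (lie x) z = 0%R ->
  iter (m + n) (lie x) (lie y z) = 0%R.
Proof.
move: {-1}(m + n) (erefl (m + n)) => s; elim: s m n y z => [|s IH] m n y z.
  by case: m => // _ /= ->; rewrite lie0l.
case: m => [_ /= ->|m]; first by rewrite lie0l iter_lie0 lie0r.
case: n => [_ _ /= ->|n]; first by rewrite lie0r iter_lie0 lie0r.
rewrite addSn => -[e] hy hz; rewrite iterSr lie_leibniz.
rewrite -[lie (lie x y) z]scale1r iter_lieP scale1r.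
rewrite (IH m n.+1) // -?iterSr // add0r.
by apply: (IH m.+1 n); rewrite -?iterSr // addSn -addnS.
Qed.

(** The exponent may depend on [y]; in finite dimension some power of [lie x] still kills all of
    [K]. *)
Definition ad_nilpotent K :=
  forall x y, x \in K -> y \in K -> exists n, iter n (lie x) y = 0%R.

(* If some [ad x] is not nilpotent on [K], its Fitting null component lies in
   a maximal subalgebra [A]; as [x \in A] and [A] is an ideal, [A] also contains
   the Fitting one component, hence all of [K]. *)
Lemma max_ideals_ad_nilpotent K : subalgebra K ->
    (forall A, maximal_subalgebra A K -> (lie_prod K A <= A)%VS) ->
  ad_nilpotent K.
Proof.
move=> /subalgebraP sK hA x y0 xK.
have [||K0 K0P] := @vspace_of_pred F L (fun y => y \in K /\ exists n, iter n (lie x) y = 0%R).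
- by split; [exact: mem0v | exists 0].
- move=> a u v [uK [m hu]] [vK [n hv]]; split; first by rewrite rpredD ?rpredZ.
  exists (maxn m n); rewrite iter_lieP.
  by rewrite (iter_lie_eq0 (leq_maxl m n) hu) (iter_lie_eq0 (leq_maxr m n) hv) scaler0 add0r.
have sK0 : subalgebra K0.
  apply/subalgebraP => u v /K0P[uK [m hu]] /K0P[vK [n hv]]; apply/K0P.
  by split; [exact: sK | exists (m + n); exact: iter_lie_lie].
have sK0K : (K0 <= K)%VS by apply/subvP => u /K0P[].
case: (pselect (K0 = K)) => [<- /K0P[] //|neq].
have [A mA sK0A] := max_subalgebra_ex sK0 sK0K neq.
have xA : x \in A.
  by apply: (subvP sK0A); apply/K0P; split=> //; exists 1; rewrite /= liexx.
have /lie_prodP iA := hA _ mA.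
have [_ sAK nAK _] := mA.
(* [f k] is the image of [K] under the [k]-th power of [lie x]. A term of least dimension is
   stationary and is the Fitting one component. *)
pose f k := iter k (fun U => (linfun (lie x) @: U)%VS) K.
have fP k v : v \in f k -> exists2 u, u \in K & v = iter k (lie x) u.
  elim: k v => [|k IH] v; first by exists v.
  by case/memv_imgP => w /IH[u uK ->] ->; exists u; rewrite ?lfunE.
have mem_f k u : u \in K -> iter k (lie x) u \in f k.
  move=> uK; elim: k => //= k IH.
  by rewrite -[lie x _](lfunE (lie x)) memv_img.
have dec k : (f k.+1 <= f k)%VS.
  elim: k => [|k IH]; last exact: limgS.
  apply/subvP => _ /memv_imgP[u uK ->]; rewrite lfunE; exact: sK.
have decD k j : (f (k + j)%N <= f k)%VS.
  by elim: j => [|j IH]; rewrite ?addn0 ?addnS // (subv_trans (dec _)).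
pose q n := `[< exists k, \dim (f k) = n >].
have ex0 : exists n, q n by eexists; apply/asboolP; exists 0.
case: (ex_minnP ex0) => d /asboolP[k <-] dmin.
have fE j : f (k + j) = f k.
  apply/eqP; rewrite eqEdim decD; apply: dmin; apply/asboolP; by exists (k + j).
exfalso; apply: nAK; apply/eqP; rewrite eqEsubv sAK; apply/subvP => y yK.
(* Fitting decomposition of [y]: the power [k.+1] sends [y] and some iterate [iter k.+1 (lie x) z]
   to the same vector. Their difference lies in [K0], and the iterate lies in [A] because the
   positive exponent provides a bracket with [x]. *)
have : iter k.+1 (lie x) y \in f (k.+1 + k.+1).
  rewrite addSn -addnS fE -(fE 1) addn1; exact: mem_f.
case/fP => z zK; rewrite iterD => e.
rewrite -(subrK (iter k.+1 (lie x) z) y) rpredD //.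
  apply: (subvP sK0A); apply/K0P; split.
    by rewrite rpredB //; elim: (k.+1) => //= j IH; apply: sK.
  exists k.+1; rewrite addrC -scaleN1r iter_lieP e scaleN1r addNr //.
rewrite iterS lieC memvN iA //.
by elim: (k) => //= j IH; apply: sK.
Qed.

(* Engel's theorem for the action of [B] on [V / U]. *)
Lemma engel K B U V : ad_nilpotent K -> subalgebra B -> (B <= K)%VS ->
    (V <= K)%VS -> (U <= V)%VS -> U <> V ->
    (lie_prod B U <= U)%VS -> (lie_prod B V <= V)%VS ->
  exists v, [/\ v \in V, v \notin U & forall b, b \in B -> lie b v \in U].
Proof.
move=> nilK; have [n] := ubnP (\dim B); elim: n => // n IH in B U V *.
move=> leB sB sBK sVK sUV nUV BU BV.
case: (pselect (B = 0%VS)) => [->|nB].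
  have [v vV vU] := memv_neq sUV nUV; exists v; split=> // b.
  by rewrite memv0 => /eqP->; rewrite lie0l mem0v.
have [A [sA sAB nAB mAB] _] := max_subalgebra_ex subalgebra0 (sub0v B) (not_eq_sym nB).
have ltA : \dim A < n by apply: leq_trans (dimv_ltn sAB nAB) _.
have sAK := subv_trans sAB sBK.
have AU : (lie_prod A U <= U)%VS by apply: subv_trans BU; apply: lie_prodS.
have AV : (lie_prod A V <= V)%VS by apply: subv_trans BV; apply: lie_prodS.
have AB : (lie_prod A B <= B)%VS by apply: subv_trans sB; apply: lie_prodS.
(* Induction for the action of [A] on [B / A]: [x] normalizes [A], so [B] is [A] plus the line of
   [x]. *)
have [x [xB xA Ax]] := IH A A B ltA sA sAK sBK sAB nAB sA AB.
have eB : B = (A + <[x]>)%VS.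
  case: (mAB (A + <[x]>)%VS) => [||| /esym /(add_line_neq xA) | //] //.
  - exact: subalgebra_add_line.
  - exact: addvSl.
  - by rewrite subv_add sAB.
have [w [wV wU Aw]] := IH A U V ltA sA sAK sVK sUV nUV AU AV.
have [m0 hm0] := nilK _ _ (subvP sBK _ xB) (subvP sVK _ wV).
(* The vector sought is the last iterate of [w] under [lie x] outside [U]: [x] sends it into [U] by
   choice of [m]. *)
have ex0 : exists m, iter m (lie x) w \in U by exists m0; rewrite hm0 mem0v.
case: (ex_minnP ex0) => [[|m]]; first by rewrite /= (negPf wU).
move=> hm mmin; exists (iter m (lie x) w).
(* [A] sends every iterate into [U], because commuting [a] past [x] costs only the bracket
   [lie a x], which is again in [A]. *)
have inv j : iter j (lie x) w \in V /\ forall a, a \in A -> lie a (iter j (lie x) w) \in U.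
  elim: j => [|j [jV jA]] //=; split; first exact: (lie_prodP _ _ _ BV).
  move=> a aA; rewrite lie_leibniz rpredD ?jA ?Ax //.
  by apply: (lie_prodP _ _ _ BU); rewrite ?jA.
have [mV mA] := inv m; split=> //.
  by apply/negP => /mmin; rewrite ltnn.
move=> b; rewrite eB => /memv_addP[a aA [_ /vlineP[c ->] ->]].
by rewrite lieDl lieZl rpredD ?mA // rpredZ.
Qed.

(** Engel for a maximal subalgebra [A] of [P] acting on [P / A] gives a vector outside [A]
    normalizing it. Hence the derived algebra of [P] falls into [A], against perfectness. *)
Lemma ad_nilpotent_perfect0 K P :
  ad_nilpotent K -> (P <= K)%VS -> lie_prod P P = P -> P = 0%VS.
Proof.
move=> nilK sPK pP; apply: contrapT => nP.
have sP : subalgebra P by rewrite /subalgebra pP.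
have [A [sA sAP nAP mAP] _] := max_subalgebra_ex subalgebra0 (sub0v P) (not_eq_sym nP).
have AP : (lie_prod A P <= P)%VS by rewrite -[X in (_ <= X)%VS]pP; apply: lie_prodS.
have [x [xP xA Ax]] := engel nilK sA (subv_trans sAP sPK) sPK sAP nAP sA AP.
have eP : P = (A + <[x]>)%VS.
  case: (mAP (A + <[x]>)%VS) => [||| /esym /(add_line_neq xA) | //] //.
  - exact: subalgebra_add_line.
  - exact: addvSl.
  - by rewrite subv_add sAP.
have := lie_prod_add_line sA Ax; rewrite -eP pP => sPA.
by apply: nAP; apply/eqP; rewrite eqEsubv sAP.
Qed.

(** * Chains of maximal subalgebras, peeled from the bottom *)

Lemma n_maximal_subalgebraS n A : n_maximal_subalgebra n.+1 A <->
  exists2 K, maximal_subalgebra A K & n_maximal_subalgebra n K.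
Proof.
split=> [[C [<- CL mC]]|[K mK [C [C0 CL mC]]]].
  exists (C 1); first exact: mC.
  by exists (fun i => C i.+1); split=> // i ?; apply: mC.
exists (fun i => if i is j.+1 then C j else A); split=> // -[|i] lti; last exact: mC.
by rewrite C0.
Qed.

Lemma n_maximal_subalgebra1 M :
  n_maximal_subalgebra 1 M <-> maximal_subalgebra M fullv.
Proof.
split=> [/n_maximal_subalgebraS[K mK [C [C0 CL _]]] | mM].
  by rewrite -CL C0.
by apply/n_maximal_subalgebraS; exists fullv => //; exists (fun=> fullv).
Qed.

End LieLemmas.

(** * Dimension of 2-maximal subalgebras when all 3-maximal ones are ideals *)

Section ThreeMaximal.
Variables (F : fieldType) (L : lieAlgType F).
Implicit Types (x y z : L) (A I J K M P U V W : {vspace L}).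
Hypothesis ideal3 : forall M, n_maximal_subalgebra 3 M -> is_lie_ideal M.

Lemma two_maximal_ideal K :
  n_maximal_subalgebra 2 K -> 1 < \dim K -> is_lie_ideal K.
Proof.
move=> n2K dK; have /n_maximal_subalgebraS[M [sK _ _ _] _] := n2K.
have id A : maximal_subalgebra A K -> is_lie_ideal A.
  by move=> mA; apply: ideal3; apply/n_maximal_subalgebraS; exists K.
have nK0 : 0%VS <> K by move=> e; move: dK; rewrite -e dimv0.
have [A mA _] := max_subalgebra_ex (subalgebra0 L) (sub0v K) nK0.
have [sA sAK nAK hA] := mA.
have [x xK xA] := memv_neq sAK nAK.
(* The dimension hypothesis makes the line of [x] proper in [K], so it lies in a second maximal
   subalgebra [B], different from [A]. *)
have nxK : <[x]>%VS <> K by move=> e; move: dK; rewrite -e dim_vline ltnNge leq_b1.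
have sxK : (<[x]> <= K)%VS by rewrite -memvE.
have [B mB xB] := max_subalgebra_ex (subalgebra_line x) sxK nxK.
have [_ sBK _ _] := mB.
have iAB := lie_ideal_add (id _ mA) (id _ mB).
case: (hA (A + B)%VS); last by [move=> <-].
- exact: ideal_subalgebra (subvf _) iAB.
- exact: addvSl.
- by rewrite subv_add sAK.
- move=> e; case/negP: xA; rewrite -e; apply: (subvP (addvSr A B)).
  by rewrite memvE.
Qed.

Lemma two_maximal_dim K :
  ~ lie_solvable L -> n_maximal_subalgebra 2 K -> \dim K <= 1.
Proof.
move=> nsol n2K; rewrite leqNgt; apply/negP => dK.
have [P pP nP] := nonsolvable_perfect nsol.
have iK := two_maximal_ideal n2K dK.
have [M mK n1M] : exists2 M, maximal_subalgebra K M & n_maximal_subalgebra 1 M.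
  exact/n_maximal_subalgebraS.
have [sK sKM nKM _] := mK.
have [sMM dM] := max_ideal_codim1 mK (lie_ideal_in M iK).
have id A : maximal_subalgebra A K -> is_lie_ideal A.
  by move=> mA; apply: ideal3; apply/n_maximal_subalgebraS; exists K.
have iM : is_lie_ideal M.
  have nK0 : 0%VS <> K by move=> e; move: dK; rewrite -e dimv0.
  have [A mA _] := max_subalgebra_ex (subalgebra0 L) (sub0v K) nK0.
  have [sA sAK _ _] := mA.
  have [_ dKA] := max_ideal_codim1 mA (lie_ideal_in K (id _ mA)).
  have [x xM xK] := memv_neq sKM nKM.
  have xA : x \notin A by apply: contra xK; apply: (subvP sAK).
  have eM := max_ideal_add_line mK (lie_ideal_in M iK) xM xK.
  (* [A + <[x]>] has the dimension of [K], so it has codimension one in [M] and is 2-maximal too;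
     with [K] it spans [M]. *)
  have sK' : subalgebra (A + <[x]>).
    apply: subalgebra_add_line => // u uA; rewrite lieC memvN.
    exact: (is_lie_idealP _ (id _ mA)).
  have sK'M : (A + <[x]> <= M)%VS by rewrite eM addvS.
  have dK' : \dim (A + <[x]>) = \dim K.
    apply/eqP; rewrite eqn_leq dKA dimv_add_line /=.
    exact: dimv_ltn (addvSl _ _) (add_line_neq xA).
  have iK' : is_lie_ideal (A + <[x]>).
    apply: two_maximal_ideal; last by rewrite dK'.
    by apply/n_maximal_subalgebraS; exists M => //; apply: codim1_maximal; rewrite ?dK'.
  suff -> : M = (K + (A + <[x]>))%VS by apply: lie_ideal_add.
  by rewrite addvA (addv_idPl sAK).
have /n_maximal_subalgebra1 mM := n1M.
have [sLM _] := max_ideal_codim1 mM iM.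
(* A perfect subalgebra descends through successive abelian quotients, first into [M] and then into
   [K]. *)
have sPM : (P <= M)%VS by apply: subv_trans (perfect_sub pP (subvf P)) sLM.
have sPK : (P <= K)%VS by apply: subv_trans (perfect_sub pP sPM) sMM.
apply: nP; apply: ad_nilpotent_perfect0 sPK pP.
apply: max_ideals_ad_nilpotent => // A mA; exact/lie_ideal_in/id.
Qed.

End ThreeMaximal.

(** * Algebras whose maximal subalgebras have dimension at most one *)

Section SmallMaximal.
Variables (F : fieldType) (L : lieAlgType F).
Implicit Types (x y z : L) (A I J K M P U V W : {vspace L}).

(** A maximal subalgebra that is an ideal would contain the derived algebra, which is [M]. A proper
    nonzero ideal would fill the maximal subalgebra above it, and a zero maximal subalgebra would be
    an ideal; both are excluded. *)
Lemma perfect_small_maximal_simple M :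
    lie_prod M M = M -> M <> 0%VS ->
    (forall K, maximal_subalgebra K M -> \dim K <= 1) ->
  lie_simple M /\ forall K, maximal_subalgebra K M -> \dim K = 1.
Proof.
move=> pM nM small.
have sM : subalgebra M by rewrite /subalgebra pM.
have notid K : maximal_subalgebra K M -> ~ (lie_prod M K <= K)%VS.
  move=> mK iK; have [_ sKM nKM _] := mK.
  have [] := max_ideal_codim1 mK iK; rewrite pM => sMK _.
  by apply: nKM; apply/eqP; rewrite eqEsubv sKM.
split; last first.
  move=> K mK; apply/eqP; rewrite eqn_leq small //= lt0n dimv_eq0.
  apply/negP => /eqP e; apply: (notid _ mK); rewrite e; apply/lie_prodP => x y _.
  by rewrite memv0 => /eqP->; rewrite lie0r mem0v.
split; rewrite ?pM // => I sIM iI.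
case: (pselect (I = M)) => [|nI]; [by right | left].
have [K mK sIK] := max_subalgebra_ex (ideal_subalgebra sIM iI) sIM nI.
apply: contrapT => nI0; apply: (notid _ mK).
suff <- : I = K by [].
apply/eqP; rewrite eqEdim sIK (leq_trans (small _ mK)) // lt0n dimv_eq0.
exact/eqP.
Qed.

(** A proper derived algebra lies in some maximal subalgebra, which is then an ideal of codimension
    one. *)
Lemma small_maximal_dichotomy M :
    subalgebra M -> (forall K, maximal_subalgebra K M -> \dim K <= 1) ->
  lie_prod M M = M \/ \dim M <= 2.
Proof.
move=> sM small; case: (pselect (lie_prod M M = M)) => [|nD]; [by left | right].
have sD : subalgebra (lie_prod M M) by apply: lie_prodS.
have [U mU sDU] := max_subalgebra_ex sD sM nD.
have [_ sUM _ _] := mU.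
have [_ ->] := max_ideal_codim1 mU (subv_trans (lie_prodS (subvv M) sUM) sDU).
by rewrite ltnS small.
Qed.

End SmallMaximal.

(** * Correspondence between subalgebras of a quotient and those above the ideal *)

Section Quotient.
Variables (F : fieldType) (L : lieAlgType F) (I : lie_ideal L).
Implicit Types (x y : L) (J K M : {vspace L}) (N : {vspace (lie_quot I)}).

Definition quot_map (x : L) : lie_quot I := (\pi_(lie_quot I) x)%qT.

Fact quot_map_is_linear : linear quot_map. Proof. exact: quot_pi_is_linear. Qed.
HB.instance Definition _ := GRing.isSemilinear.Build F L (lie_quot I) *:%R
  quot_map (GRing.semilinear_linear quot_map_is_linear).

Definition quot_hom : 'Hom(L, lie_quot I) := linfun quot_map.
Local Notation f := quot_hom.

Lemma quot_hom_lie x y : f (lie x y) = lie (f x) (f y).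
Proof. by rewrite !lfunE; apply: lie_quot_pi. Qed.

Lemma lker_quot_hom : lker f = I.
Proof. by apply/vspaceP => x; rewrite memv_ker lfunE /= lie_quot_eq0. Qed.

Lemma limg_quot_hom : limg f = fullv.
Proof.
apply/eqP; rewrite eqEsubv subvf; apply/subvP => q _.
have -> : q = f (repr q) by rewrite lfunE /= /quot_map reprK.
exact/memv_img/memvf.
Qed.

Lemma quot_hom_prod J K : (f @: lie_prod J K)%VS = lie_prod (f @: J) (f @: K).
Proof.
apply/eqP; rewrite eqEsubv; apply/andP; split.
  apply/subvP => _ /memv_imgP[z zJK ->]; rewrite memv_preim; move: z zJK.
  apply/subvP/lie_prodP => x y xJ yK.
  by rewrite -memv_preim quot_hom_lie memv_lie ?memv_img.
apply/lie_prodP => _ _ /memv_imgP[x xJ ->] /memv_imgP[y yK ->].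
by rewrite -quot_hom_lie memv_img ?memv_lie.
Qed.

Lemma quot_hom_preimK N : (f @: (f @^-1: N))%VS = N.
Proof. by rewrite lpreimK // limg_quot_hom subvf. Qed.

Lemma quot_hom_imgK K : (I <= K)%VS -> (f @^-1: (f @: K))%VS = K.
Proof.
move=> /subvP sIK; apply/vspaceP => x; rewrite -memv_preim.
apply/idP/idP => [/memv_imgP[y yK e] | xK]; last exact: memv_img.
rewrite -(subrK y x) rpredD //; apply: sIK; rewrite -lker_quot_hom memv_ker.
by rewrite linearB /= e subrr.
Qed.

Lemma sub_quot_hom_preim N : (I <= f @^-1: N)%VS.
Proof. by rewrite -lker_quot_hom -lpreim0 lpreimS ?sub0v. Qed.

Lemma dim_quot_hom K : (I <= K)%VS -> \dim K = \dim I + \dim (f @: K).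
Proof. by move=> sIK; rewrite -[LHS](limg_ker_dim f) lker_quot_hom (capv_idPr sIK). Qed.

Lemma subalgebra_quot_hom K : subalgebra K -> subalgebra (f @: K).
Proof. by move=> sK; rewrite /subalgebra -quot_hom_prod limgS. Qed.

Lemma subalgebra_quot_preim N : subalgebra N -> subalgebra (f @^-1: N).
Proof.
move=> /subalgebraP sN; apply/subalgebraP => x y; rewrite -!memv_preim.
by rewrite quot_hom_lie; apply: sN.
Qed.

Lemma maximal_quot_hom K : maximal_subalgebra K fullv -> (I <= K)%VS ->
  maximal_subalgebra (f @: K) fullv.
Proof.
move=> [sK _ nK hK] sIK; split; rewrite ?subvf ?subalgebra_quot_hom //.
  by move=> e; apply: nK; rewrite -(quot_hom_imgK sIK) e -limg_quot_hom quot_hom_imgK ?subvf.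
move=> N sN sKN _.
case: (hK (f @^-1: N)%VS (subalgebra_quot_preim sN)); rewrite ?subvf //.
- by rewrite -(quot_hom_imgK sIK) lpreimS.
- by move=> <-; rewrite quot_hom_preimK; left.
- by move=> e; right; rewrite -(quot_hom_preimK N) e limg_quot_hom.
Qed.

Lemma maximal_quot_preim N : maximal_subalgebra N fullv ->
  maximal_subalgebra (f @^-1: N) fullv.
Proof.
move=> [sN _ nN hN]; split; rewrite ?subvf ?subalgebra_quot_preim //.
  by move=> e; apply: nN; rewrite -(quot_hom_preimK N) e limg_quot_hom.
move=> K sK sNK _; have sIK := subv_trans (sub_quot_hom_preim N) sNK.
case: (hN (f @: K)%VS (subalgebra_quot_hom sK)); rewrite ?subvf //.
- by rewrite -(quot_hom_preimK N) limgS.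
- by move=> <-; rewrite quot_hom_imgK //; left.
- by move=> e; right; rewrite -(quot_hom_imgK sIK) e -limg_quot_hom quot_hom_imgK ?subvf.
Qed.

Lemma quot_simple :
    lie_prod fullv fullv = fullv :> {vspace L} -> I <> fullv :> {vspace L} ->
    (forall J, is_lie_ideal J -> (I <= J)%VS -> J = I \/ J = fullv) ->
  lie_simple (fullv : {vspace (lie_quot I)}).
Proof.
move=> pL nI hI; split; first exact: subvf.
  (* Were the quotient abelian, perfectness of [L] would make it zero and [I] all of [L]. *)
  rewrite -limg_quot_hom -quot_hom_prod pL limg_quot_hom => e; apply: nI.
  by apply/eqP; rewrite -lker_quot_hom -lpreim0 -e -limg_quot_hom quot_hom_imgK ?subvf.
move=> N _ iN; have iJ : is_lie_ideal (f @^-1: N).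
  apply/is_lie_idealP => x y; rewrite -!memv_preim quot_hom_lie.
  by apply: (is_lie_idealP _ iN).
case: (hI _ iJ (sub_quot_hom_preim N)) => e; rewrite -(quot_hom_preimK N) e.
  left; apply/eqP; rewrite -subv0; apply/subvP => _ /memv_imgP[x xI ->].
  by rewrite memv0 -memv_ker lker_quot_hom.
by right; rewrite limg_quot_hom.
Qed.

End Quotient.

(** * From small 2-maximal subalgebras to the three cases *)

Section Classification.
Variables (F : fieldType) (L : lieAlgType F).
Hypothesis nonsol : ~ lie_solvable L.
Implicit Types (x y z : L) (I J K M N : {vspace L}).

Lemma dim_derived_nonsolvable : 2 < \dim (lie_prod (fullv : {vspace L}) fullv).
Proof.
have [P pP nP] := nonsolvable_perfect nonsol.
exact: leq_trans (dim_perfect pP nP) (dimvS (perfect_sub pP (subvf P))).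
Qed.

(** [L] acts on the line by scalars, which commute, so brackets act as zero; by perfectness brackets
    span [L]. *)
Lemma ideal_line_central z : lie_prod fullv fullv = fullv :> {vspace L} ->
  is_lie_ideal <[z]> -> z \in lie_center L.
Proof.
move=> pL /is_lie_idealP iz; apply/lie_centerP => y.
have [||C CP] := @vspace_of_pred F L (fun y => lie z y = 0%R).
- exact: lie0r.
- by move=> a u v hu hv; rewrite liePr hu hv scaler0 addr0.
apply/CP; have : (fullv <= C)%VS; last by move/subvP->; rewrite ?memvf.
rewrite -pL; apply/lie_prodP => u v _ _; apply/CP.
have /vlineP[a ha] := iz u z (memv_line z).
have /vlineP[b hb] := iz v z (memv_line z).
rewrite lie_leibniz (lieC z u) (lieC z v) ha hb -!scaleNr lieZl lieZr.
by rewrite (lieC z v) ha hb -scaleNr !scalerA mulrNN mulNr [(b * a)%R]mulrC -scalerDl subrr scale0r.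
Qed.

(** A central vector outside [M] would make [M] an ideal of codimension one, containing the derived
    algebra [L]. *)
Lemma center_maximal M : lie_prod fullv fullv = fullv :> {vspace L} ->
  maximal_subalgebra M fullv -> (lie_center L <= M)%VS.
Proof.
move=> pL [sM _ nM hM]; apply/subvP => z zZ; apply: contrapT => /negP zM.
have Mz u : u \in M -> lie u z \in M.
  by move=> _; rewrite lieC (lie_centerP _ zZ) oppr0 mem0v.
case: (hM (M + <[z]>)%VS); rewrite ?subvf ?addvSl //.
- exact: subalgebra_add_line.
- by move=> /esym /(add_line_neq zM).
- move=> e; apply: nM; have := lie_prod_add_line sM Mz.
  by rewrite e pL => sLM; apply/eqP; rewrite eqEsubv subvf.
Qed.

Hypothesis small : forall K, n_maximal_subalgebra 2 K -> \dim K <= 1.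

Lemma small_maximal M : maximal_subalgebra M fullv ->
  forall K, maximal_subalgebra K M -> \dim K <= 1.
Proof.
move=> /n_maximal_subalgebra1 n1M K mK; apply: small.
by apply/n_maximal_subalgebraS; exists M.
Qed.

Lemma nonsimple_classification I :
    is_lie_ideal I -> I <> 0%VS -> I <> fullv ->
  (exists (S : {vspace L}) (x : L),
      [/\ directv (S + <[x]>)%VS, (S + <[x]>)%VS = fullv, is_lie_ideal S, lie_simple S
        & forall M, maximal_subalgebra M S -> \dim M = 1])
  \/ [/\ lie_simple (fullv : {vspace (lie_quot (center_lie_ideal L))}),
         forall M : {vspace (lie_quot (center_lie_ideal L))},
           maximal_subalgebra M fullv -> \dim M = 1,
         lie_center L = frattini L
       & \dim (lie_center L) = 1].
Proof.
set A3 := ex _; move=> iI nI0 nI.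
case: (pselect A3) => [|nA3]; [by left | right].
have dL := dim_derived_nonsolvable.
(* Outside case (iii), an ideal below a maximal subalgebra is small. *)
have idsub J : is_lie_ideal J -> J <> 0%VS -> forall M, maximal_subalgebra M fullv ->
    (J <= M)%VS -> \dim M = 2 /\ \dim J = 1.
  move=> iJ nJ0 M mM sJM; have [sM _ nM _] := mM.
  have nM0 : M <> 0%VS.
    by move=> e; apply: nJ0; apply/eqP; rewrite -subv0 -e.
  have notidM : \dim M <= 2 -> ~ is_lie_ideal M.
    move=> dM iM; have [/dimvS sLM _] := max_ideal_codim1 mM iM.
    by move: dL; rewrite ltnNge (leq_trans sLM).
  have smallM := small_maximal mM.
  case: (small_maximal_dichotomy sM smallM) => [pM|dM].
    have [simM maxM] := perfect_small_maximal_simple pM nM0 smallM.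
    (* If [M] is simple, the ideal [J] inside it must be [M], so [M] is an ideal of codimension one
       and (iii) holds. *)
    case: nA3; have [_ _ /(_ J sJM (lie_ideal_in M iJ))] := simM.
    case=> // eJ; rewrite eJ in iJ.
    have [x _ xM] := memv_neq (subvf M) nM.
    have eL := max_ideal_add_line mM iJ (memvf x) xM.
    exists M, x; split=> //; rewrite directvEgeq /=.
    rewrite -eL; have [_ ->] := max_ideal_codim1 mM iJ.
    by rewrite -addn1 leq_add2l dim_vline leq_b1.
  have nJM : J <> M by move=> e; apply: (notidM dM); rewrite -e.
  have J0 : 0 < \dim J by rewrite lt0n dimv_eq0; apply/eqP.
  have ltJM := dimv_ltn sJM nJM.
  split; apply/eqP; rewrite eqn_leq ?dM ?J0 ?andbT; first exact: leq_trans ltJM.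
  by rewrite -ltnS (leq_trans ltJM).
have iddim J : is_lie_ideal J -> J <> 0%VS -> J <> fullv -> \dim J = 1.
  move=> iJ nJ0 nJ.
  have [M mM sJM] := max_subalgebra_ex (ideal_subalgebra (subvf J) iJ) (subvf J) nJ.
  by have [] := idsub J iJ nJ0 M mM sJM.
(* The derived algebra is an ideal of dimension above two, whereas proper nonzero ideals are
   lines. *)
have pL : lie_prod fullv fullv = fullv :> {vspace L}.
  apply: contrapT => nD; have := dL; rewrite iddim //.
    by apply: lie_prodS; rewrite ?subvf.
  by move=> e; move: dL; rewrite e dimv0.
have nZ : lie_center L <> fullv.
  move=> e; have : lie_prod fullv fullv = 0%VS :> {vspace L}; last first.
    by move=> e0; move: dL; rewrite e0 dimv0.
  apply/eqP; rewrite -subv0; apply/lie_prodP => u v _ _.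
  have /lie_centerP -> : u \in lie_center L by rewrite e memvf.
  exact: mem0v.
have iZ := center_ideal L.
have nZ0 : lie_center L <> 0%VS.
  have [z zI] := memv_neq (sub0v I) (not_eq_sym nI0); rewrite memv0 => nz e.
  have eI : <[z]>%VS = I.
    by apply/eqP; rewrite eqEdim -memvE zI (iddim I) // dim_vline nz.
  have : z \in lie_center L by apply: ideal_line_central; rewrite ?eI.
  by rewrite e memv0 (negPf nz).
have dZ := iddim _ iZ nZ0 nZ.
have ltZ J : is_lie_ideal J -> (lie_center L <= J)%VS -> J = lie_center L \/ J = fullv.
  move=> iJ sZJ; case: (pselect (J = fullv)) => [|nJ]; [by right | left].
  apply/esym/eqP; rewrite eqEdim sZJ dZ iddim // => e; apply: nZ0.
  by apply/eqP; rewrite -subv0 -e.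
split=> //.
- exact: (@quot_simple F L (center_lie_ideal L)).
- move=> N mN; have mM := maximal_quot_preim mN.
  have sZM := sub_quot_hom_preim N.
  have [dM _] := idsub _ iZ nZ0 _ mM sZM.
  have := dim_quot_hom sZM; rewrite quot_hom_preimK dM dZ add1n.
  by case.
have [[iPhi hPhi] maxPhi] := frattiniP L.
have sZPhi : (lie_center L <= frattini L)%VS.
  by apply: maxPhi; split=> // M; apply: center_maximal.
(* The Frattini ideal lies above the centre, so it is the centre or [L]; the latter fails since it
   lies in a proper maximal subalgebra. *)
case: (ltZ _ iPhi sZPhi) => // e.
have [M mM _] := max_subalgebra_ex (ideal_subalgebra (subvf I) iI) (subvf I) nI.
have [_ _ nM _] := mM.
by case: nM; apply/eqP; rewrite eqEsubv subvf -e hPhi.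
Qed.

(** A nonzero vector [y] of a maximal [M] either spans [M] or lies in a maximal subalgebra of [M],
    which is then a 2-maximal line. [M] is nonzero, since any line lies strictly between zero and
    [L]. *)
Lemma simple_classification : lie_simple (fullv : {vspace L}) ->
    (exists K, n_maximal_subalgebra 2 K /\ \dim K = 1)
  \/ (forall M, maximal_subalgebra M fullv -> \dim M = 1).
Proof.
move=> [_ nL _]; case: (pselect (exists K, n_maximal_subalgebra 2 K /\ \dim K = 1)).
  by left.
move=> no; right => M mM; have [sM _ nM hM] := mM.
have dL := leq_trans dim_derived_nonsolvable (dimvS (subvf _)).
have [x _ xM] := memv_neq (subvf M) nM.
have dM1 : M <> 0%VS.
  move=> e; case: (hM <[x]>%VS (subalgebra_line x)); rewrite ?subvf //.
  - by rewrite e sub0v.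
  - by move=> ex; move: xM; rewrite -ex memv_line.
  - by move=> ex; move: dL; rewrite -ex dim_vline ltnNge (leq_trans (leq_b1 _)).
have [y yM] := memv_neq (sub0v M) (not_eq_sym dM1); rewrite memv0 => ny.
case: (pselect (<[y]>%VS = M)) => [<-|nyM]; first by rewrite dim_vline ny.
have syM : (<[y]> <= M)%VS by rewrite -memvE.
have [K mK sK] := max_subalgebra_ex (subalgebra_line y) syM nyM.
case: no; exists K; split.
  by apply/n_maximal_subalgebraS; exists M => //; apply/n_maximal_subalgebra1.
apply/eqP; rewrite eqn_leq (small_maximal mM mK).
by have := dimvS sK; rewrite dim_vline ny.
Qed.

End Classification.

(** * From the three cases back to 3-maximal ideals *)

Section Converse.
Variables (F : fieldType) (L : lieAlgType F).
Implicit Types (x y z : L) (I J K M N : {vspace L}).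

Lemma is_lie_ideal0 : is_lie_ideal (0%VS : {vspace L}).
Proof. by apply/is_lie_idealP => x y; rewrite memv0 => /eqP->; rewrite lie0r mem0v. Qed.

(** Being proper in a subalgebra of dimension at most one, a 3-maximal subalgebra is zero. *)
Lemma three_maximal_ideal_of_small :
    (forall K, n_maximal_subalgebra 2 K -> \dim K <= 1) ->
  forall M, n_maximal_subalgebra 3 M -> is_lie_ideal M.
Proof.
move=> small M /n_maximal_subalgebraS[K [sM sMK nMK _] /small dK].
have := leq_trans (dimv_ltn sMK nMK) dK.
rewrite ltnS leqn0 dimv_eq0 => /eqP->; exact: is_lie_ideal0.
Qed.

Lemma two_maximal_small :
    (forall M, maximal_subalgebra M fullv ->
       \dim M <= 2 \/ forall K, maximal_subalgebra K M -> \dim K <= 1) ->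
  forall K, n_maximal_subalgebra 2 K -> \dim K <= 1.
Proof.
move=> h K /n_maximal_subalgebraS[M mK /n_maximal_subalgebra1 /h[dM|]]; last exact.
have [_ sKM nKM _] := mK.
by rewrite -ltnS (leq_trans (dimv_ltn sKM nKM)).
Qed.

(** [S] has codimension at most one, so a proper [M] above it equals it. Otherwise [S] and [M] meet
    in a proper subalgebra of [S], of dimension at most one, and the dimension formula bounds
    [M]. *)
Lemma maximal_dim_extension S x M : (S + <[x]>)%VS = fullv -> subalgebra S ->
    (forall K, maximal_subalgebra K S -> \dim K = 1) ->
    maximal_subalgebra M fullv -> \dim M <= 2 \/ M = S.
Proof.
move=> eL sS maxS [sM _ nM hM].
case: (pselect (S <= M)%VS) => [sSM|nSM].
  case: (pselect (S = fullv)) => [eS | nS].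
    by case: nM; apply/eqP; rewrite eqEsubv subvf -eS.
  right; apply: contrapT => nMS.
  have := dimv_ltn sSM (not_eq_sym nMS); have := dimv_ltn (subvf M) nM.
  rewrite -eL => h1 h2.
  by have := leq_trans h1 (dimv_add_line S x); rewrite ltnS leqNgt h2.
left; pose N := (S :&: M)%VS.
have sN : subalgebra N.
  apply/subalgebraP => u v; rewrite !memv_cap => /andP[uS uM] /andP[vS vM].
  by rewrite (subalgebraP _ sS) // (subalgebraP _ sM).
have nNS : N <> S by move=> e; apply: nSM; rewrite -e capvSr.
have [K mK sNK] := max_subalgebra_ex sN (capvSl S M) nNS.
have dN : \dim N <= 1 by rewrite -(maxS K mK) dimvS.
have dSM : \dim (S + M) <= (\dim S).+1.
  by apply: leq_trans (dimvS (subvf _)) _; rewrite -eL dimv_add_line.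
have := dimv_sum_cap S M; rewrite -/N => e.
rewrite -(leq_add2l (\dim S)) -e; apply: leq_trans (leq_add dSM dN) _.
by rewrite addSnnS.
Qed.

End Converse.

Theorem theorem3p3 (F : fieldType) (L : lieAlgType F) (hL : ~ lie_solvable L) :
  (forall M : {vspace L}, n_maximal_subalgebra 3 M -> is_lie_ideal M)
  <->
  [\/ [/\ lie_simple (fullv : {vspace L}),
          forall M : {vspace L}, n_maximal_subalgebra 2 M -> \dim M <= 1
        & exists M : {vspace L}, n_maximal_subalgebra 2 M /\ \dim M = 1],
      [/\ lie_simple (fullv : {vspace (lie_quot (center_lie_ideal L))}),
          forall M : {vspace (lie_quot (center_lie_ideal L))},
            maximal_subalgebra M fullv -> \dim M = 1,
          lie_center L = frattini L
        & \dim (lie_center L) = 0 \/ \dim (lie_center L) = 1]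
    | exists (S : {vspace L}) (x : L),
        [/\ directv (S + <[x]>)%VS,
            (S + <[x]>)%VS = fullv,
            is_lie_ideal S, lie_simple S
          & forall M : {vspace L}, maximal_subalgebra M S -> \dim M = 1]].
Proof.
split=> [ideal3 | cls].
  have small (K : {vspace L}) : n_maximal_subalgebra 2 K -> \dim K <= 1.
    exact: (two_maximal_dim ideal3 hL).
  have nab : lie_prod fullv fullv <> 0%VS :> {vspace L} by move=> e; apply: hL; exists 1.
  case: (pselect (lie_simple (fullv : {vspace L}))) => [simL | nsim].
    case: (simple_classification hL small simL) => [ex1 | max1]; first by constructor 1.
    have e0 : <[0%R : L]>%VS = 0%VS by apply/eqP; rewrite -dimv_eq0 dim_vline eqxx.
    (* (iii) does not require x <> 0, so x = 0 covers the simple case of (ii). *)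
    constructor 3; exists fullv, 0%R.
    by split=> //; rewrite ?directvEgeq /= ?e0 ?addv0 ?dimv0 ?addn0 //; exact: subvf.
  have [I [iI nI0 nI]] : exists I : {vspace L}, [/\ is_lie_ideal I, I <> 0%VS & I <> fullv].
    apply: contrapT => no; apply: nsim; split=> //; first exact: subvf.
    move=> I _ iI; apply: contrapT => /not_orP[nI0 nI]; apply: no; by exists I.
  case: (nonsimple_classification hL small iI nI0 nI) => [|[]]; first by constructor 3.
  by constructor 2; split=> //; right.
apply: three_maximal_ideal_of_small.
case: cls => [[_ small _] // | [_ max1 eZ dZ] | [S [x [_ eL iS _ maxS]]]].
  (* In case (ii) every maximal subalgebra contains the centre and has a one-dimensional image
     modulo it, hence dimension at most two. *)
  apply: two_maximal_small => M mM; left.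
  have sZM : (lie_center L <= M)%VS by rewrite eZ; have [[_ ->]] := frattiniP L.
  rewrite (@dim_quot_hom F L (center_lie_ideal L)) //=.
  rewrite max1 ?addn1 ?ltnS; last exact: maximal_quot_hom.
  by case: dZ => ->.
apply: two_maximal_small => M mM.
case: (maximal_dim_extension eL (ideal_subalgebra (subvf S) iS) maxS mM) => [|->].
  by left.
by right=> K /maxS ->.
Qed.
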